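(* Let $N\ge100$, $\varepsilon\in(0,1/2]$, $p\in[0,1]$, and let $T$ be any quantum channel on $\mathcal{B}(\mathbb{C}^N)$; the quantum register $\mathbb{C}^N$ is subject to the noise $D_p(\varrho)=(1-p)\varrho+pT(\varrho)$. Consider the following algorithm (with $c=10$ and $\alpha_g(\varepsilon):=\big(1+\frac{g}{c\log(1/\varepsilon)}\big)^{-1/2}$), repeated for rounds $g=0,1,2,\ldots$: (1) prepare $|\psi\rangle=\frac1{\sqrt N}\sum_{y=1}^N|y\rangle$; (2) perform $k_g:=\lfloor\alpha_g(\varepsilon)\frac\pi4\sqrt N\rfloor$ noisy Grover iterations, i.e. the state becomes $(D_p\circ G_x)^{k_g}(|\psi\rangle\langle\psi|)$ with $G_x(\varrho)=U_x\varrho U_x^\dagger$, $U_x=(I-2|\psi\rangle\langle\psi|)O_x$, where $O_x|y\rangle=(-1)^{\delta_{xy}}|y\rangle$; (3) measure in the standard basis and verify the outcome with one (noiseless) oracle query, storing it in a noiseless classical output register if it equals $x$. Each round uses $k_g+1$ oracle queries. Then, for the marked element $x$ chosen uniformly at random from $\{1,\ldots,N\}$, the probability that the marked element has not been found within the first $$100\left(Np+\sqrt N\right)\log\frac1\varepsilon$$ oracle queries is at most $\varepsilon$.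
   Context: $\log$ is the natural logarithm. The algorithm does not depend on (or know) $p$ or $T$. *)

(* Defs.v *)
From HB Require Import structures.
From mathcomp Require Import all_boot all_order all_algebra.
From mathcomp Require Import all_classical all_reals.
From mathcomp Require Import exp trigo.
From mathcomp Require Import complex.
Set Implicit Arguments. Unset Strict Implicit. Unset Printing Implicit Defensive.
Import Order.TTheory GRing.Theory Num.Theory.
Local Open Scope ring_scope.
Local Open Scope complex_scope.

Section Quantum.
Variable R : realType.
Local Notation C := R[i].
Variable N : nat.
Local Notation Mx := 'M[C]_N.

Definition adjmx m n (A : 'M[C]_(m, n)) : 'M[C]_(n, m) := \matrix_(i, j) (A j i)^*.

Definition is_linear_map (T : Mx -> Mx) :=
  forall (a : C) (A B : Mx), T (a *: A + B) = a *: T A + T B.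

(* complete positivity: for every m, T (x) id_m maps positive semidefinite
   block matrices [X_ij]_{i,j<m} (blocks in B(C^N)) to positive semidefinite ones.
   Positive semidefinite over C: v^* X v >= 0 for all vectors v. *)
Definition block_psd m (X : 'I_m -> 'I_m -> Mx) :=
  forall v : 'I_m -> 'cV[C]_N,
    0 <= \sum_(i < m) \sum_(j < m) (adjmx (v i) *m X i j *m v j) 0 0.

Definition completely_positive (T : Mx -> Mx) :=
  forall m (X : 'I_m -> 'I_m -> Mx), block_psd X -> block_psd (fun i j => T (X i j)).

Definition trace_preserving (T : Mx -> Mx) := forall A : Mx, \tr (T A) = \tr A.

Definition quantum_channel (T : Mx -> Mx) :=
  [/\ is_linear_map T, completely_positive T & trace_preserving T].

Definition psi : 'cV[C]_N := \col_(y < N) ((Num.sqrt (N%:R : R))^-1)%:C.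
Definition psi_proj : Mx := psi *m adjmx psi.

Definition oracle (x : 'I_N) : Mx :=
  \matrix_(i, j) (if i == j then (if i == x then -1 else 1) else 0).

Definition grover_U (x : 'I_N) : Mx := (1%:M - 2%:R *: psi_proj) *m oracle x.
Definition grover_G (x : 'I_N) (rho : Mx) : Mx := grover_U x *m rho *m adjmx (grover_U x).

Definition noise (p : R) (T : Mx -> Mx) (rho : Mx) : Mx :=
  (1 - p)%:C *: rho + p%:C *: T rho.

Definition cpar : R := 10%:R.
Definition alpha (eps : R) (g : nat) : R :=
  (Num.sqrt (1 + g%:R / (cpar * ln (1 / eps))))^-1.
Definition kg (eps : R) (g : nat) : nat :=
  Num.truncn (alpha eps g * (pi / 4%:R) * Num.sqrt (N%:R : R)).

Definition round_state (eps p : R) (T : Mx -> Mx) (x : 'I_N) (g : nat) : Mx :=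
  iter (kg eps g) (fun rho => noise p T (grover_G x rho)) psi_proj.

(* probability that the standard-basis measurement in round g yields x (Born rule) *)
Definition round_success (eps p : R) (T : Mx -> Mx) (x : 'I_N) (g : nat) : R :=
  complex.Re (round_state eps p T x g x x).

Definition queries (eps : R) (n : nat) : nat := \sum_(g < n) (kg eps g).+1.

Definition budget (eps p : R) : R :=
  100%:R * (N%:R * p + Num.sqrt (N%:R : R)) * ln (1 / eps).

(* For fixed marked element x, rounds are independent; x is found within the
   budget Q iff some round g whose verification query is among the first Q
   queries (i.e. queries (g+1) <= Q) succeeds.  Such g satisfy g < Q, so the
   product ranges over g < truncn Q + 1 with that condition. *)
Definition fail_prob_x (eps p : R) (T : Mx -> Mx) (x : 'I_N) : R :=
  \prod_(g < (Num.truncn (budget eps p)).+1 | (queries eps g.+1)%:R <= budget eps p)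
     (1 - round_success eps p T x g).

Definition fail_prob (eps p : R) (T : Mx -> Mx) : R :=
  (N%:R)^-1 * \sum_(x < N) fail_prob_x eps p T x.

End Quantum.

(* Main.v *)
(* Split the state after k noisy Grover iterations into the branch in which no
   noise occurred, of weight (1-p)^k, and a remainder; complete positivity makes
   the remainder positive semidefinite, so a round of k iterations succeeds with
   probability at least (1-p)^k A_k^2, where A_k is the noiseless amplitude of
   the marked element.  Put W = 1 + p sqrt N, u = 10 log(1/eps) and
   tau_g = 1/alpha_g = sqrt(1 + g/u).  In the rounds with 3W/2 <= tau_g <= 2W the
   number k_g is small enough (about sqrt N / W) that (1-p)^(k_g) is bounded
   below by Bernoulli's inequality, and large enough that each such round
   succeeds with probability at least 1/(16 W^2).  There are at least
   16 W^2 log(1/eps) of them, and all rounds up to the last one together use at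
   most 10 u W sqrt N queries, which is the budget.  Only 2 <= pi < 4 is used. *)
Require Import Defs.
From HB Require Import structures.
From mathcomp Require Import all_boot all_order all_algebra.
From mathcomp Require Import all_classical all_reals.
From mathcomp Require Import sequences exp trigo.
From mathcomp Require Import complex.
From mathcomp Require Import ring lra.
Import Order.TTheory GRing.Theory Num.Theory.
Local Open Scope ring_scope.

(** * Elementary estimates for a single round *)

Lemma bernoulli_ge (R : realDomainType) (p : R) (k : nat) :
  0 <= p -> p <= 1 -> 1 - k%:R * p <= (1 - p) ^+ k.
Proof.
move=> p0 p1; elim: k => [|k IHk]; first by rewrite mul0r subr0 expr0.
rewrite exprS -natr1.
have k0 : 0 <= k%:R :> R by [].
have : (1 - p) * (1 - k%:R * p) <= (1 - p) * (1 - p) ^+ k.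
  by rewrite ler_wpM2l // subr_ge0.
have : 0 <= k%:R * p * p by rewrite !mulr_ge0.
lra.
Qed.

(* On the vector a |x> + b sum_y |y>, one noiseless Grover iteration acts, up to
   sign, on (a, b) by grover_step with r = 1/N. *)
Definition grover_step {R : pzRingType} (r : R) (ab : R * R) : R * R :=
  (ab.1 + 2 * ab.2, ab.2 - 2 * r * (ab.1 + 2 * ab.2)).

Definition grover_coef {R : pzRingType} (r s : R) (k : nat) : R * R :=
  iter k (grover_step r) (0, s).

(** Both coordinates are polynomials in [r]; the upper bounds keep the terms of order 0 and the
    lower bounds those of order at most 1. All four are proved in one induction:
    [2 * r * k%:R ^+ 2 <= 3] keeps [a + 2 * b] nonnegative, so [b] decreases, and each bound feeds
    the next. *)
Lemma grover_coef_bounds (R : realFieldType) (r s : R) (k : nat) :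
    0 <= r -> 0 <= s -> 2 * r * k%:R ^+ 2 <= 3 ->
  let: (a, b) := grover_coef r s k in
  [/\ a <= 2 * k%:R * s, b <= s,
      s * (1 - 2 * r * k%:R * (k%:R + 1)) <= b &
      2 * s * k%:R * (1 - 2 / 3 * r * (k%:R ^+ 2 - 1)) <= a].
Proof.
move=> r0 s0; elim: k => [|k IHk] /=.
  by rewrite /= !(mulr0, mul0r, subr0, mulr1).
rewrite -natr1; set x : R := k%:R in IHk * => hk.
have x0 : 0 <= x by [].
have rx0 : 0 <= r * x by rewrite mulr_ge0.
have {}/IHk : 2 * r * x ^+ 2 <= 3 by move: hk rx0; lra.
rewrite /grover_coef /=; case: (iter k _ _) => a b /= [ha hb hb' ha'].
have a0 : 0 <= a + 2 * b.
  have : 0 <= 2 * s * (x + 1) * (1 - 2 / 3 * r * ((x + 1) ^+ 2 - 1)).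
    rewrite mulr_ge0 //; last by move: hk r0; lra.
    by rewrite !mulr_ge0 // addr_ge0.
  by move: ha' hb'; lra.
have h1 : r * (a + 2 * b) <= r * (2 * (x + 1) * s) by rewrite ler_wpM2l //; lra.
have h2 : 0 <= r * (a + 2 * b) by rewrite mulr_ge0.
split; lra.
Qed.

Lemma grover_coef_sum_ge (R : realFieldType) (r s : R) (k : nat) :
    0 <= r -> 0 <= s -> 2 * r * k%:R ^+ 2 <= 3 ->
  s * (2 * k%:R + 1) * (1 - 2 / 3 * r * k%:R * (k%:R + 1))
    <= (grover_coef r s k).1 + (grover_coef r s k).2.
Proof.
move=> r0 s0 hk; have := @grover_coef_bounds R r s k r0 s0 hk.
by case: grover_coef => a b /= [_ _ hb ha]; lra.
Qed.

(* With q = pi/4, the right-hand side times alpha_g^2 bounds the success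
   probability of a round with k_g >= 1 from below: the inner square accounts for
   A_k falling short of (2k+1) / sqrt N, and the last factor for (1-p)^k. *)
Lemma success_poly_ge (R : realFieldType) (q : R) : 1 / 2 <= q -> q <= 1 ->
  1 / 4 <= 9 / 4 * q ^+ 2 * ((1 - 2 / 3 * (4 / 9 * q ^+ 2 + q / 15)) ^+ 2
           * (1 - 2 / 3 * q)).
Proof.
move=> q_ge q_le.
(* The factor [9 / 4 * q ^+ 2] increases with [q] and the others decrease, so on [[l, u]] they are
   evaluated at [l] and [u] respectively. Four subintervals suffice. *)
have bound (l u : R) : 1 / 2 <= l -> l <= q -> q <= u -> u <= 1 ->
    1 / 4 <= 9 / 4 * l ^+ 2 * ((1 - 2 / 3 * (4 / 9 * u ^+ 2 + u / 15)) ^+ 2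
           * (1 - 2 / 3 * u)) ->
    1 / 4 <= 9 / 4 * q ^+ 2 * ((1 - 2 / 3 * (4 / 9 * q ^+ 2 + q / 15)) ^+ 2
           * (1 - 2 / 3 * q)).
  move=> l0 lq qu u1 /le_trans; apply.
  have l2 : l ^+ 2 <= q ^+ 2 by rewrite ler_sqr ?nnegrE; lra.
  have u2 : q ^+ 2 <= u ^+ 2 by rewrite ler_sqr ?nnegrE; lra.
  have u21 : u ^+ 2 <= 1 by rewrite exprn_ile1 //; lra.
  apply: ler_pM.
  - by rewrite mulr_ge0 ?sqr_ge0 //; lra.
  - by rewrite mulr_ge0 ?sqr_ge0 //; lra.
  - by lra.
  apply: ler_pM; rewrite ?sqr_ge0 //; try lra.
  by rewrite ler_sqr ?nnegrE; lra.
case: (lerP q (3/5)) => h1; first by apply: (bound (1/2) (3/5)); lra.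
case: (lerP q (3/4)) => h2; first by apply: (bound (3/5) (3/4)); lra.
case: (lerP q (22/25)) => h3; first by apply: (bound (3/4) (22/25)); lra.
by apply: (bound (22/25) 1); lra.
Qed.

(** Used with [S] = sqrt N, [q] = pi/4, [t] = alpha_g, [k] = k_g. Since [t * W >= 1 / 2], it is
    enough to reach [t ^+ 2 / 4]. *)
Lemma noisy_success_ge (R : realFieldType) (S p q t : R) (k : nat) :
    10 <= S -> 0 <= p -> p <= 1 -> 1 / 2 <= q -> q <= 1 ->
    1 / 2 <= t * (1 + S * p) -> t * (1 + S * p) <= 2 / 3 ->
    k%:R <= t * q * S -> t * q * S < k%:R + 1 ->
  (16 * (1 + S * p) ^+ 2)^-1 <= (1 - p) ^+ k
    * ((grover_coef (S ^- 2) S^-1 k).1 + (grover_coef (S ^- 2) S^-1 k).2) ^+ 2.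
Proof.
move=> S10 p0 p1 q_ge q_le tW_ge tW_le k_le k_gt.
set ab := grover_coef _ _ _.
have Sp : 0 <= S * p by rewrite mulr_ge0 //; lra.
set W := 1 + S * p in tW_ge tW_le *.
have W1 : 1 <= W by rewrite /W; lra.
have S0 : S != 0 by apply/eqP; lra.
have t0 : 0 <= t.
  by rewrite leNgt; apply/negP => t0; have : t * W <= 0; [rewrite nmulr_rle0|]; lra.
have t23 : t <= 2 / 3.
  by apply: le_trans tW_le; rewrite ler_peMr.
have s0 : 0 < S^-1 by rewrite invr_gt0; lra.
have s10 : S^-1 <= 1 / 10 by rewrite -[1 / 10]invrK lef_pV2 ?posrE ?invr_gt0; lra.
have t2 : (16 * W ^+ 2)^-1 <= 1 / 4 * t ^+ 2.
  rewrite -[leLHS]mul1r ler_pdivrMr; last by rewrite mulr_gt0 ?exprn_gt0 //; lra.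
  have : (1 / 2) ^+ 2 <= (t * W) ^+ 2 by rewrite ler_sqr ?nnegrE; lra.
  by lra.
(* Without iterations the success probability is [S ^- 2]; here [t * q * S < 1], and
   [q ^+ 2 >= 1 / 4]. *)
have [k0|k1] := posnP k.
  rewrite k0 add0r in k_gt; rewrite /ab k0 /= expr0 mul1r add0r.
  have tq : t * q <= S^-1 by rewrite -[S^-1]mul1r ler_pdivlMr; lra.
  apply: le_trans t2 _; apply: (@le_trans _ _ ((t * q) ^+ 2)).
    rewrite exprMn mulrC ler_wpM2l ?sqr_ge0 //.
    by apply: le_trans (_ : (1 / 2) ^+ 2 <= _); [|rewrite ler_sqr ?nnegrE]; lra.
  by rewrite ler_sqr ?nnegrE //; [rewrite mulr_ge0 //; lra | lra].
have kR : 1 <= k%:R :> R by rewrite ler1n.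
have r0 : 0 <= S ^- 2 by rewrite invr_ge0 sqr_ge0.
have sk_le : S^-1 * k%:R <= t * q.
  by rewrite mulrC ler_pdivrMr //; lra.
have sk0 : 0 <= S^-1 * k%:R by rewrite mulr_ge0 //; lra.
have tq_le : t * q <= 2 / 3 * q by rewrite ler_wpM2r //; lra.
(* From [t <= 2 / 3] and [S^-1 <= 1 / 10]; the two bounds together control the term
   [r * k * (k + 1)] in the amplitude and give the constants of [X]. *)
have rk2 : S ^- 2 * k%:R ^+ 2 <= 4 / 9 * q ^+ 2.
  have -> : 4 / 9 * q ^+ 2 = (2 / 3 * q) ^+ 2 by field.
  by rewrite -exprVn -exprMn ler_sqr ?nnegrE; lra.
have rk : S ^- 2 * k%:R <= q / 15.
  rewrite -exprVn expr2 -mulrA.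
  by apply: le_trans (_ : 1 / 10 * (2 / 3 * q) <= _); [apply: ler_pM|]; lra.
have q2 : q ^+ 2 <= 1 by rewrite exprn_ile1 //; lra.
have hk : 2 * S ^- 2 * k%:R ^+ 2 <= 3 by lra.
have h1 := @grover_coef_sum_ge R _ _ k r0 (ltW s0) hk; rewrite -/ab in h1.
set X := 1 - 2 / 3 * (4 / 9 * q ^+ 2 + q / 15).
have X0 : 0 <= X by rewrite /X; lra.
(* For [k >= 1], [2k + 1 >= 3/2 (k + 1)], and [k + 1 > t * q * S]. *)
have amp : 3 / 2 * (t * q) * X <= ab.1 + ab.2.
  apply: le_trans h1; apply: ler_pM; rewrite ?X0 //.
  - by rewrite !mulr_ge0 //; lra.
  - have : S^-1 * (t * q * S) <= S^-1 * (k%:R + 1) by rewrite ler_wpM2l //; lra.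
    have -> : S^-1 * (t * q * S) = t * q by field.
    have : S^-1 * 1 <= S^-1 * k%:R by rewrite ler_wpM2l //; lra.
    lra.
  - by rewrite /X; lra.
have amp0 : 0 <= 3 / 2 * (t * q) * X by rewrite !mulr_ge0 //; lra.
have noise_ge : 1 - 2 / 3 * q <= (1 - p) ^+ k.
  apply: le_trans (bernoulli_ge _ _ k p0 p1).
  have h2 : k%:R * p <= t * q * S * p by rewrite ler_wpM2r.
  have h3 : t * (S * p) * q <= t * W * q.
    by rewrite ler_wpM2r ?ler_wpM2l // /W; lra.
  have h4 : t * W * q <= 2 / 3 * q by rewrite ler_wpM2r //; lra.
  lra.
apply: le_trans t2 _.
apply: (@le_trans _ _ ((1 - 2 / 3 * q) * (3 / 2 * (t * q) * X) ^+ 2)).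
  have -> : (1 - 2 / 3 * q) * (3 / 2 * (t * q) * X) ^+ 2
          = 9 / 4 * q ^+ 2 * (X ^+ 2 * (1 - 2 / 3 * q)) * t ^+ 2 by field.
  by rewrite ler_wpM2r ?sqr_ge0 // success_poly_ge.
apply: ler_pM; rewrite ?sqr_ge0 //; first by lra.
by rewrite ler_sqr ?nnegrE //; lra.
Qed.

(** * Sums and products over rounds *)

Lemma sum_inv_sqrt_le (R : rcfType) (u : R) (n : nat) : 1 <= u ->
  \sum_(g < n.+1) (Num.sqrt (1 + g%:R / u))^-1 <= 2 * u * Num.sqrt (1 + n%:R / u).
Proof.
move=> u1; have u0 : 0 < u by lra.
elim: n => [|n IHn].
  by rewrite big_ord1 mul0r addr0 sqrtr1 invr1; lra.
rewrite big_ord_recr /=; apply: le_trans (lerD IHn (lexx _)) _.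
set x := Num.sqrt (1 + n%:R / u); set y := Num.sqrt (1 + n.+1%:R / u).
have nu : 0 <= n%:R / u by rewrite divr_ge0 // ltW.
have n1u : 0 <= n.+1%:R / u by rewrite divr_ge0 // ltW.
have x2 : x ^+ 2 = 1 + n%:R / u by rewrite sqr_sqrtr //; lra.
have y2 : y ^+ 2 = 1 + n.+1%:R / u by rewrite sqr_sqrtr //; lra.
have y0 : 0 < y by rewrite sqrtr_gt0; lra.
(* Discrete form of integrating [(1 + g/u)^(-1/2)]: since [1 = u (y - x) (y + x)] and [x <= y], the
   new term satisfies [1/y <= 2u (y - x)], and the sum telescopes. *)
have e : u * (y ^+ 2 - x ^+ 2) = 1.
  by rewrite x2 y2 -natr1; field; apply/eqP; lra.
rewrite -lerBrDl -[_^-1]mul1r ler_pdivrMr // -[leLHS]e.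
have : 0 <= u * (y - x) ^+ 2 by rewrite mulr_ge0 ?sqr_ge0 // ltW.
lra.
Qed.

(** Factors outside the window [m <= g < n] are at most 1 and are dropped. *)
Lemma prod_le_expn (R : realFieldType) (f : nat -> R) (P : pred nat) (c : R)
    (m n M : nat) :
    (m <= n)%N -> (n <= M)%N -> (forall g, 0 <= f g <= 1) ->
    (forall g, (m <= g < n)%N -> P g && (f g <= c)) ->
  \prod_(g < M | P g) f g <= c ^+ (n - m).
Proof.
move=> mn nM f01 fc.
have prod01 a b : 0 <= \prod_(a <= g < b | P g) f g <= 1.
  by rewrite prodr_ge0 ?prodr_ile1 // => i _; case/andP: (f01 i).
rewrite -(big_mkord P f) (big_cat_nat (leq0n m) (leq_trans mn nM)).
rewrite (big_cat_nat mn nM) /=.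
have /andP[a0 a1] := prod01 0%N m; have /andP[c0 c1] := prod01 n M.
apply: le_trans (ler_piMl _ a1) _; first by rewrite mulr_ge0 //; case/andP: (prod01 m n).
apply: le_trans (ler_piMr _ c1) _; first by case/andP: (prod01 m n).
rewrite -prodr_const_nat big_nat_cond [leRHS]big_nat_cond.
rewrite (eq_bigl (fun g => (m <= g < n)%N && true)) => [|g].
  by apply: ler_prod => g; rewrite andbT => /fc/andP[_ ->]; case/andP: (f01 g) => ->.
by case h : (m <= g < n)%N => //=; case/andP: (fc g h).
Qed.

(** * Positive semidefinite matrices and unitarity of the Grover iteration *)

Section GroverState.
Local Open Scope complex_scope.

Lemma adjmxE (R : realType) m n (A : 'M[R[i]]_(m, n)) :
  adjmx A = (map_mx (@conjc R) A)^T.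
Proof. by apply/matrixP => i j; rewrite !mxE. Qed.

Lemma adjmxM (R : realType) m n q (A : 'M[R[i]]_(m, n)) (B : 'M[R[i]]_(n, q)) :
  adjmx (A *m B) = adjmx B *m adjmx A.
Proof. by rewrite !adjmxE map_mxM trmx_mul. Qed.

Lemma adjmxK (R : realType) m n (A : 'M[R[i]]_(m, n)) : adjmx (adjmx A) = A.
Proof. by apply/matrixP => i j; rewrite !mxE conjcK. Qed.

Lemma adjmxN (R : realType) m n (A : 'M[R[i]]_(m, n)) : adjmx (- A) = - adjmx A.
Proof. by rewrite !adjmxE map_mxN linearN. Qed.

(** In the order on [R[i]], [0 <= z] forces [z] to be real, so Hermitian symmetry is implied. *)
Definition psdmx {R : realType} {N : nat} (A : 'M[R[i]]_N) : Prop :=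
  forall v : 'cV[R[i]]_N, 0 <= (adjmx v *m A *m v) 0 0.

Lemma psdmxD (R : realType) N (A B : 'M[R[i]]_N) :
  psdmx A -> psdmx B -> psdmx (A + B).
Proof. by move=> A0 B0 v; rewrite mulmxDr mulmxDl mxE addr_ge0. Qed.

Lemma psdmxZ (R : realType) N (c : R[i]) (A : 'M[R[i]]_N) :
  0 <= c -> psdmx A -> psdmx (c *: A).
Proof. by move=> c0 A0 v; rewrite -scalemxAr -scalemxAl mxE mulr_ge0. Qed.

Lemma psdmx_conj (R : realType) N (U A : 'M[R[i]]_N) :
  psdmx A -> psdmx (U *m A *m adjmx U).
Proof.
by move=> A0 v; have := A0 (adjmx U *m v); rewrite adjmxM adjmxK !mulmxA.
Qed.

Lemma psdmx_outer (R : realType) N (u : 'cV[R[i]]_N) : psdmx (u *m adjmx u).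
Proof.
move=> v; have -> : adjmx v *m (u *m adjmx u) *m v
    = (adjmx v *m u) *m adjmx (adjmx v *m u).
  by rewrite adjmxM adjmxK !mulmxA.
by rewrite !mxE big_ord1 !mxE mulcJ_ge0.
Qed.

Lemma psdmx_diag (R : realType) N (A : 'M[R[i]]_N) x : psdmx A -> 0 <= A x x.
Proof.
move=> /(_ (delta_mx x 0)).
have -> : adjmx (delta_mx x 0) = delta_mx 0 x :> 'rV[R[i]]_N.
  by rewrite adjmxE map_delta_mx trmx_delta.
by rewrite -rowE -colE !mxE.
Qed.

Lemma psdmx_cp (R : realType) N (T : 'M[R[i]]_N -> 'M[R[i]]_N) A :
  completely_positive T -> psdmx A -> psdmx (T A).
Proof.
(* Positivity is the one-block case of complete positivity. *)
move=> cpT A0 v; have /(_ (fun=> v)) : block_psd (fun _ _ : 'I_1 => T A).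
  by apply: (cpT 1%N (fun _ _ => A)) => w; rewrite !big_ord1.
by rewrite !big_ord1.
Qed.

Lemma psi_normed (R : realType) N : (0 < N)%N ->
  adjmx (psi R N) *m psi R N = 1%:M.
Proof.
move=> N0; apply/matrixP => i j; rewrite !ord1 !mxE.
under eq_bigr => y _ do rewrite !mxE conjc_real -rmorphM.
rewrite sumr_const card_ord -rmorphMn /= -expr2 exprVn sqr_sqrtr //.
by rewrite -mulr_natr mulVf ?pnatr_eq0 -?lt0n.
Qed.

Lemma oracle_involutive (R : realType) N (x : 'I_N) :
  adjmx (oracle R x) *m oracle R x = 1%:M.
Proof.
apply/matrixP => i j; rewrite !mxE (bigD1 j) //= big1 => [|k kj].
  rewrite !mxE eqxx [j == i]eq_sym addr0; case: (eqVneq i j) => [_|_].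
    by case: (j == x); rewrite ?rmorphN1 ?rmorph1 ?mulrNN mulr1.
  by rewrite rmorph0 mul0r.
by rewrite !mxE (negPf kj) mulr0.
Qed.

Lemma grover_U_unitary (R : realType) N (x : 'I_N) :
  adjmx (grover_U R x) *m grover_U R x = 1%:M.
Proof.
have N0 : (0 < N)%N by apply: leq_ltn_trans (ltn_ord x).
have PP : psi_proj R N *m psi_proj R N = psi_proj R N.
  by rewrite /psi_proj mulmxA -[psi R N *m _ *m _]mulmxA psi_normed // mulmx1.
have adjP : adjmx (1%:M - 2%:R *: psi_proj R N) = 1%:M - 2%:R *: psi_proj R N.
  rewrite adjmxE map_mxB map_scalar_mx map_mxZ rmorph1 rmorph_nat linearB linearZ /=.
  by rewrite tr_scalar_mx -adjmxE adjmxM adjmxK.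
rewrite /grover_U adjmxM adjP -mulmxA [(1%:M - _) *m (_ *m _)]mulmxA.
suff -> : (1%:M - 2%:R *: psi_proj R N) *m (1%:M - 2%:R *: psi_proj R N) = 1%:M.
  by rewrite mul1mx oracle_involutive.
rewrite mulmxBl mul1mx -scalemxAl mulmxBr mulmx1 -scalemxAr PP.
have e : (2%:R * 2%:R) *: psi_proj R N = 2%:R *: psi_proj R N + 2%:R *: psi_proj R N.
  by rewrite -scalerDl -natrD -natrM.
by rewrite scalerBr scalerA e opprB addrK subrK.
Qed.

Lemma mxtrace_grover_G (R : realType) N (x : 'I_N) (A : 'M[R[i]]_N) :
  \tr (grover_G x A) = \tr A.
Proof. by rewrite mxtrace_mulC mulmxA grover_U_unitary mul1mx. Qed.

(** * Noisy evolution of the state and the Born-rule probability *)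

Definition grover_vec {R : realType} {N : nat} (x : 'I_N) (ab : R * R) : 'cV[R[i]]_N :=
  \col_y (ab.1 *+ (y == x) + ab.2)%:C.

Lemma grover_vec0 (R : realType) N (x : 'I_N) :
  grover_vec x (0, (Num.sqrt N%:R)^-1) = psi R N.
Proof. by apply/matrixP => i j; rewrite !mxE /= mul0rn add0r. Qed.

(** [1 - 2 psi_proj] is the negative of the usual diffusion operator, hence the sign; it cancels in
    [v *m adjmx v]. *)
Lemma grover_U_vec (R : realType) N (x : 'I_N) (ab : R * R) :
  grover_U R x *m grover_vec x ab
  = - grover_vec x (grover_step (Num.sqrt N%:R ^- 2) ab).
Proof.
case: ab => a b.
have N0 : (0 < N)%N by apply: leq_ltn_trans (ltn_ord x).
set w := oracle R x *m grover_vec x (a, b).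
have wE y : w y 0 = (b - (a + 2 * b) *+ (y == x))%:C.
  rewrite mxE (bigD1 y) //= big1 => [|z zy].
    rewrite !mxE eqxx addr0 /=; case: (y == x).
      by rewrite mulN1r -rmorphN /=; congr (_%:C); rewrite /= !mulr1n; ring.
    by rewrite mul1r /= mulr0n subr0 add0r.
  by rewrite !mxE eq_sym (negPf zy) mul0r.
have psiw : (adjmx (psi R N) *m w) 0 0
    = ((Num.sqrt N%:R)^-1 * (N%:R * b - (a + 2 * b)))%:C.
  rewrite mxE; under eq_bigr => y _ do
    rewrite wE [adjmx _ _ _]mxE [psi _ _ _ _]mxE conjc_real -rmorphM.
  rewrite -rmorph_sum -mulr_sumr sumrB sumr_const card_ord /=.
  congr ((_ * (_ - _))%:C); first by rewrite mulr_natl.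
  by rewrite (bigD1 x) //= eqxx big1 ?addr0 // => y /negPf ->.
have sN : (Num.sqrt N%:R)^-1 * (Num.sqrt N%:R)^-1 = (N%:R : R)^-1.
  by rewrite -expr2 exprVn sqr_sqrtr.
apply/matrixP => y j; rewrite !ord1 /grover_U -mulmxA -/w mulmxBl mul1mx.
rewrite -scalemxAl /psi_proj -mulmxA mxE wE mxE mxE mxE big_ord1 psiw !mxE /=.
have e2 : 2%:R = (2%:R)%:C :> R[i] by rewrite rmorph_nat.
rewrite e2 -!rmorphM -rmorphB -rmorphN; congr (_%:C) => /=.
rewrite [_^-1 * (_^-1 * _)]mulrA sN sqr_sqrtr //; set z := _ *+ _.
have N_neq0 : N%:R != 0 :> R by rewrite pnatr_eq0 -lt0n.
by field.
Qed.

Lemma iter_noise_decomp (R : realType) N (p : R) (T : 'M[R[i]]_N -> 'M[R[i]]_N)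
    (x : 'I_N) (k : nat) :
    0 <= p -> p <= 1 -> quantum_channel T ->
  let rho := iter k (fun rho => noise p T (grover_G x rho)) (psi_proj R N) in
  let v := grover_vec x (grover_coef (Num.sqrt N%:R ^- 2) (Num.sqrt N%:R)^-1 k) in
  [/\ psdmx rho, \tr rho = 1 &
      psdmx (rho - ((1 - p) ^+ k)%:C *: (v *m adjmx v))].
Proof.
move=> p0 p1 [_ cpT trT]; have N0 : (0 < N)%N by apply: leq_ltn_trans (ltn_ord x).
elim: k => [|k /=].
  split=> /=.
  - exact: psdmx_outer.
  - by rewrite mxtrace_mulC psi_normed // mxtrace1 rmorph1.
  - rewrite expr0 rmorph1 scale1r grover_vec0 subrr => v.
    by rewrite mulmx0 mul0mx mxE.
set rho := iter k _ _; rewrite /grover_coef /= -/(grover_coef _ _ k).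
set ab := grover_coef _ _ _; set v := grover_vec x ab => -[rho0 tr_rho rho_v].
have q0 : 0 <= (1 - p)%:C by rewrite ler0c subr_ge0.
have pC0 : 0 <= p%:C by rewrite ler0c.
have G0 (A : 'M[R[i]]_N) : psdmx A -> psdmx (grover_G x A) by exact: psdmx_conj.
have TG0 := psdmxZ _ _ _ _ pC0 (psdmx_cp _ _ _ _ cpT (G0 _ rho0)).
split.
- exact: psdmxD _ _ _ _ (psdmxZ _ _ _ _ q0 (G0 _ rho0)) TG0.
- rewrite /noise mxtraceD !mxtraceZ trT mxtrace_grover_G tr_rho !mulr1.
  by rewrite -rmorphD subrK rmorph1.
have -> : grover_vec x (grover_step (Num.sqrt N%:R ^- 2) ab) = - (grover_U R x *m v).
  by rewrite grover_U_vec opprK.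
rewrite adjmxN mulNmx mulmxN opprK adjmxM.
(* The new remainder is [1 - p] times the conjugated old remainder plus [p] times [T] of a positive
   matrix. *)
have -> : noise p T (grover_G x rho)
      - ((1 - p) ^+ k.+1)%:C *: (grover_U R x *m v *m (adjmx v *m adjmx (grover_U R x)))
    = (1 - p)%:C *: grover_G x (rho - ((1 - p) ^+ k)%:C *: (v *m adjmx v))
      + p%:C *: T (grover_G x rho).
  rewrite /noise addrAC; congr (_ + _).
  rewrite exprS rmorphM -scalerA -scalerBr /grover_G mulmxBr mulmxBl.
  by rewrite -scalemxAr -scalemxAl !mulmxA.
exact: psdmxD _ _ _ _ (psdmxZ _ _ _ _ q0 (G0 _ rho_v)) TG0.
Qed.

(** Lower bound: the remainder has a nonnegative diagonal. Upper bound: the state has trace 1 and a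
    nonnegative diagonal. *)
Lemma round_success_itv (R : realType) N (eps p : R) (T : 'M[R[i]]_N -> 'M[R[i]]_N)
    (x : 'I_N) (g : nat) :
    0 <= p -> p <= 1 -> quantum_channel T ->
  let ab := grover_coef (Num.sqrt N%:R ^- 2) (Num.sqrt N%:R)^-1 (kg N eps g) in
  (1 - p) ^+ kg N eps g * (ab.1 + ab.2) ^+ 2 <= round_success eps p T x g
  /\ round_success eps p T x g <= 1.
Proof.
move=> p0 p1 chT ab; have := iter_noise_decomp _ _ _ _ x (kg N eps g) p0 p1 chT.
rewrite /= -/(round_state eps p T x g) -/ab => -[rho0 tr_rho rho_v].
rewrite /round_success; set rho := round_state _ _ _ _ _ in rho0 tr_rho rho_v *.
split.
  have := psdmx_diag _ _ _ x rho_v; rewrite !mxE big_ord1 !mxE eqxx mulr1n conjc_real.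
  rewrite -!rmorphM -expr2 subr_ge0 lecE => /andP[_].
  by [].
have : rho x x <= 1.
  rewrite -tr_rho /mxtrace (bigD1 x) //= lerDl sumr_ge0 // => y _.
  exact: psdmx_diag.
by rewrite lecE => /andP[_].
Qed.
End GroverState.

(** * Query counts and the size of log(1/eps) *)

Lemma queries_le (R : realType) (N : nat) (eps : R) (n : nat) :
    1 <= cpar R * ln (1 / eps) ->
  (queries N eps n.+1)%:R <= 2 * (cpar R * ln (1 / eps)) * (pi / 4)
     * Num.sqrt N%:R * Num.sqrt (1 + n%:R / (cpar R * ln (1 / eps))) + n%:R + 1.
Proof.
move=> u1; have := sum_inv_sqrt_le R _ n u1; set u := _ * ln _ in u1 *.
have c0 : 0 <= pi / 4 * Num.sqrt N%:R :> R by rewrite mulr_ge0 ?sqrtr_ge0 ?divr_ge0 ?pi_ge0.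
move=> /(ler_wpM2l c0) sum_le.
rewrite /queries natr_sum.
(* The floor in [kg] is dropped; the [+ 1] is the verification query. *)
apply: (@le_trans _ _ (\sum_(g < n.+1) (pi / 4 * Num.sqrt N%:R * alpha eps g + 1))).
  apply: ler_sum => g _; rewrite -natr1 lerD2r /kg.
  have -> : alpha eps g * (pi / 4) * Num.sqrt N%:R
      = pi / 4 * Num.sqrt N%:R * alpha eps g by ring.
  by rewrite truncn_le mulr_ge0 ?invr_ge0 ?sqrtr_ge0.
rewrite big_split /= -mulr_sumr sumr_const card_ord -addrA natr1 lerD2r.
by apply: le_trans sum_le _; rewrite le_eqVlt; apply/orP; left; apply/eqP; ring.
Qed.

Lemma ln_inv_ge (R : realType) (eps : R) : 0 < eps -> eps <= 1 / 2 ->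
  2 / 3 <= ln (1 / eps).
Proof.
move=> e0 e2.
have -> : ln (1 / eps) = - ln eps by rewrite div1r lnV ?posrE.
rewrite lerNr -ler_expR lnK ?posrE //.
(* [1 + x <= expR x] at [x = - 1/24], raised to the power 16, suffices because
   [(23/24)^16 >= 1/2]. *)
have -> : - (2 / 3) = 16%:R * (- (1 / 24)) :> R by field.
rewrite expRM_natl; apply: (@le_trans _ _ ((1 + - (1 / 24)) ^+ 16)); first by lra.
by apply: lerXn2r; rewrite ?nnegrE ?expR_ge0 ?expR_ge1Dx //; lra.
Qed.

Lemma queries_mono (R : realType) (N : nat) (eps : R) (m n : nat) :
  (m <= n)%N -> (queries N eps m <= queries N eps n)%N.
Proof.
move=> mn; rewrite /queries -!(big_mkord xpredT (fun g => (kg N eps g).+1)).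
by rewrite (big_cat_nat (leq0n m) mn) leq_addr.
Qed.

Lemma leq_queries (R : realType) (N : nat) (eps : R) (n : nat) :
  (n <= queries N eps n)%N.
Proof.
rewrite /queries -[leqLHS]card_ord -sum1_card.
by apply: leq_sum => g _.
Qed.

(** * The window of rounds and the final count *)

Lemma fail_prob_x_le (R : realType) (N : nat) (eps p : R)
    (T : 'M[R[i]]_N -> 'M[R[i]]_N) (x : 'I_N) :
    (100 <= N)%N -> 0 < eps -> eps <= 1 / 2%:R -> 0 <= p -> p <= 1 ->
    quantum_channel T ->
  fail_prob_x eps p T x <= eps.
Proof.
move=> N100 e0 e2 p0 p1 chT.
have L23 := ln_inv_ge _ _ e0 e2.
set S : R := Num.sqrt N%:R.
have S2 : S ^+ 2 = N%:R by rewrite sqr_sqrtr.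
have S10 : 10 <= S.
  rewrite -ler_sqr ?nnegrE ?sqrtr_ge0 // S2 -natrX ler_nat.
  exact: N100.
have Sp0 : 0 <= S * p by rewrite mulr_ge0 // sqrtr_ge0.
have SpS : S * p <= S by rewrite ler_piMr // sqrtr_ge0.
pose W := 1 + S * p.
have W1 : 1 <= W by rewrite /W; lra.
have WS : W <= 11 / 10 * S by rewrite /W; lra.
have W21 : 1 <= W ^+ 2 by rewrite exprn_ege1.
pose u := cpar R * ln (1 / eps).
have uE : u = 10 * ln (1 / eps) by [].
have u6 : 6 <= u by rewrite uE; lra.
have u0 : u != 0 by apply/eqP; lra.
have QE : budget N eps p = 10 * S * W * u by rewrite /budget -/S -S2 uE /W; ring.
pose tau (g : nat) : R := Num.sqrt (1 + g%:R / u).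
(* [A] and [B] solve [tau g = 3/2 W] and [tau g = 2 W] for real [g]; the window is the set of
   integers in [(A, B]], that is [m <= g < n]. *)
pose A := u * (9 / 4 * W ^+ 2 - 1); pose B := u * (4 * W ^+ 2 - 1).
have A0 : 0 <= A by rewrite mulr_ge0 //; lra.
have AB : A <= B by rewrite ler_wpM2l //; lra.
have B0 : 0 <= B by lra.
have /andP[tA_le tA_gt] := truncn_itv A0.
have /andP[tB_le tB_gt] := truncn_itv B0.
set m := (Num.truncn A).+1 in tA_gt; set n := (Num.truncn B).+1 in tB_gt.
have mn : (m <= n)%N by rewrite ltnS le_truncn.
have tau_le g : (g < n)%N -> tau g <= 2 * W.
  rewrite ltnS => gn; have gB : g%:R <= B by apply: le_trans tB_le; rewrite ler_nat.
  rewrite -[leRHS]ger0_norm; last by lra.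
  rewrite -sqrtr_sqr ler_wsqrtr //.
  have : g%:R / u <= 4 * W ^+ 2 - 1 by rewrite ler_pdivrMr 1?mulrC //; lra.
  lra.
have tau_ge g : (m <= g)%N -> 3 / 2 * W <= tau g.
  move=> mg; have gA : A <= g%:R by apply: le_trans (ltW tA_gt) _; rewrite ler_nat.
  rewrite -[leLHS]ger0_norm; last by lra.
  rewrite -sqrtr_sqr ler_wsqrtr //.
  have : 9 / 4 * W ^+ 2 - 1 <= g%:R / u by rewrite ler_pdivlMr 1?mulrC //; lra.
  lra.
have q_ge : 1 / 2 <= pi / 4 :> R by have := @pi_ge2 R; lra.
have q_le : pi / 4 <= 1 :> R by have := @pihalf_lt2 R; lra.
(* Iterations cost at most [4 u S W]; verifications cost at most [B + 1 <= 4 u W^2 <= 4.4 u S W].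
   The total stays below [10 u S W]. *)
have queries_n : (queries N eps n)%:R <= budget N eps p.
  have u1 : 1 <= u by lra.
  apply: le_trans (queries_le _ N eps (Num.truncn B) u1) _.
  rewrite -/u -/S -/(tau (Num.truncn B)) QE.
  have h1 : 2 * u * (pi / 4) * S * tau (Num.truncn B) <= 2 * u * 1 * S * (2 * W).
    apply: ler_pM; rewrite ?tau_le ?sqrtr_ge0 ?mulr_ge0 //; try lra.
    by rewrite ler_wpM2r ?ler_wpM2l //; lra.
  have h2 : u * W * W <= u * W * (11 / 10 * S).
    by rewrite ler_wpM2l // mulr_ge0 //; lra.
  have h3 : 0 <= u * W * S by rewrite !mulr_ge0 //; lra.
  rewrite /B in tB_le; lra.
have Q0 : 0 <= budget N eps p by apply: le_trans queries_n.
pose f g := 1 - round_success eps p T x g.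
pose P g := (queries N eps g.+1)%:R <= budget N eps p.
have f01 g : 0 <= f g <= 1.
  have [s_ge s_le] := round_success_itv _ _ eps _ _ x g p0 p1 chT.
  rewrite /f subr_ge0 s_le lerBlDr lerDl; apply: le_trans s_ge.
  by rewrite mulr_ge0 ?sqr_ge0 // exprn_ge0 // subr_ge0.
have fc g : (m <= g < n)%N -> P g && (f g <= 1 - (16 * W ^+ 2)^-1).
  case/andP=> mg gn; apply/andP; split.
    by apply: le_trans queries_n; rewrite ler_nat queries_mono.
  have [s_ge _] := round_success_itv _ _ eps _ _ x g p0 p1 chT.
  rewrite lerD2l lerN2; apply: le_trans s_ge.
  have tau0 : 0 < tau g by apply: lt_le_trans (tau_ge _ mg); lra.
  have k_itv : (kg N eps g)%:R <= (tau g)^-1 * (pi / 4) * S < (kg N eps g)%:R + 1.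
    rewrite natr1; apply: truncn_itv.
    by rewrite !mulr_ge0 ?invr_ge0 ?sqrtr_ge0 //; lra.
  case/andP: k_itv => k_le k_gt.
  apply: noisy_success_ge k_le k_gt => //.
  - by rewrite -/W [_^-1 * W]mulrC ler_pdivlMr //; have := tau_le g gn; lra.
  - by rewrite -/W [_^-1 * W]mulrC ler_pdivrMr //; have := tau_ge g mg; lra.
(* Each round costs at least one query, so the index range of [fail_prob_x] contains the window. *)
have nQ : (n <= (Num.truncn (budget N eps p)).+1)%N.
  rewrite ltnW // ltnS truncn_ge_nat //; apply: le_trans queries_n.
  by rewrite ler_nat leq_queries.
apply: le_trans (prod_le_expn _ f P _ m n _ mn nQ f01 fc) _.
have D0 : 0 < 16 * W ^+ 2 by lra.
have c0 : 0 <= 1 - (16 * W ^+ 2)^-1 by rewrite subr_ge0 invf_le1 //; lra.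
apply: (@le_trans _ _ (expR (- (16 * W ^+ 2)^-1) ^+ (n - m))).
  by apply: lerXn2r; rewrite ?nnegrE ?expR_ge0 ?expR_ge1Dx.
have -> : eps = expR (- ln (1 / eps)).
  by rewrite div1r lnV ?posrE // opprK lnK ?posrE.
rewrite -expRM_natl ler_expR mulrN lerN2 ler_pdivlMr // natrB //.
(* With L = log(1/eps), [n - m >= B - A - 1 = 17.5 L W^2 - 1], and [1.5 L W^2 >= 1] pays for the
   rounding, leaving [16 L W^2]. *)
have h : (2 / 3) * W ^+ 2 <= ln (1 / eps) * W ^+ 2 by rewrite ler_wpM2r //; lra.
move: tA_le tB_gt; rewrite /m -natr1 /A /B uE.
lra.
Qed.

Theorem theorem3 (R : realType) (N : nat) (eps p : R) (T : 'M[R[i]]_N -> 'M[R[i]]_N) :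
  (100 <= N)%N ->
  0 < eps -> eps <= 1 / 2%:R ->
  0 <= p -> p <= 1 ->
  quantum_channel T ->
  fail_prob eps p T <= eps.
Proof.
move=> N100 e0 e2 p0 p1 chT.
have N0 : (0 : R) < N%:R by rewrite ltr0n; apply: leq_trans N100.
rewrite /fail_prob mulrC ler_pdivrMr //.
apply: (@le_trans _ _ (\sum_(x < N) eps)).
  by apply: ler_sum => x _; apply: fail_prob_x_le.
by rewrite sumr_const card_ord mulr_natr.
Qed.
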